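(* Let $T_*\in(0,\infty]$ and $c>0$. Let $\varphi\in L^\infty_{\mathrm{loc}}([0,T_* ))$ be non-negative and locally bounded, and suppose that for some $a\in L^1([0,T_* ))$ with $a\ge0$ it satisfies the integral inequality $$\varphi(t)\le\varphi(t_0)+\int_{t_0}^t\min\Big\{c\,\varphi(s)^2,\Big(1+\frac1{t-s}\Big)a(s)\Big\}\,ds$$ for all $0\le t_0\le t<T_*$. Then $\varphi$ satisfies, for all $t\in[0,T_* )$, $$\varphi(t)\le2^{\,1+16c\int_0^ta(s)\,ds}\Big(\varphi(0)+\frac1{8c}\Big).$$
   Context: Here $\varphi$ is a function defined pointwise on $[0,T_* )$, and ''locally bounded'' means bounded on every compact subinterval of $[0,T_* )$. *)

(* Defs.v *)
From HB Require Import structures.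
From mathcomp Require Import all_boot all_order all_algebra.
From mathcomp Require Import all_classical all_reals all_analysis.

Set Implicit Arguments.
Unset Strict Implicit.
Unset Printing Implicit Defensive.

Import Order.TTheory GRing.Theory Num.Theory.
Import numFieldNormedType.Exports.

Local Open Scope classical_set_scope.
Local Open Scope ring_scope.

(* The interval [0, T) of R; the extended right end point T may be +oo. *)
Definition time_interval (R : realType) (T : \bar R) : set R :=
  [set s | 0 <= s /\ (s%:E < T)%E].

Definition Linfty_loc (R : realType) (I : set R) (f : R -> R) : Prop :=
  measurable_fun I f /\
  forall u v : R, `[u, v] `<=` I ->
    finite_norm (@lebesgue_measure R) +oo%E (f \_ `[u, v]).

(* Pointwise boundedness, as opposed to the essential one of Linfty_loc. *)
Definition locally_bounded (R : realType) (I : set R) (f : R -> R) : Prop :=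
  forall u v : R, `[u, v] `<=` I -> [bounded f s | s in `[u, v]].

(* Main.v *)
Require Import Defs.
From HB Require Import structures.
From mathcomp Require Import all_boot all_order all_algebra.
From mathcomp Require Import all_classical all_reals all_analysis.
From mathcomp Require Import ring lra.

(** Write A(t) for the integral of a over [0, t] and S(t) for the supremum of
phi over [0, t], which is finite because phi is bounded there.  On [t0, t] the
integrand is at most c S(t)^2, and at distance more than d before the end
point it is at most (1 + 1/d) a.  Using the first bound on the last stretch of
length d and the second one before it gives
  phi(t) <= S(t0) + c S(t)^2 d + (1 + 1/d) (A(t) - A(t0)),
and the choice d = 1/(2 c S(t)) turns the quadratic term into S(t)/2, which can
be absorbed on the left ([running_sup_step]):
  S(t) <= 2 S(t0) + (2 + 4 c S(t)) (A(t) - A(t0)).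
If A(t) - A(t0) = 1/(8c), this says that S + 1/(6c) grows at most by the factor
4 = 2^2 between t0 and t, while the exponent 16 c A grows by exactly 2.  Since A
is continuous, such a t0 exists as soon as A(t) >= 1/(8c), so the estimate
  S(t) + 1/(6c) <= 2^(1 + 16 c A(t)) (phi(0) + 1/(8c))
follows by induction on the number of these steps ([running_sup_growth]).  The
induction starts on the times with 8 c A(t) <= 1, where a single application of
the same inequality with t0 = 0 suffices ([running_sup_growth_base]); the extra
factor 2 in the conclusion is what that first, incomplete step costs. *)

Set Implicit Arguments.
Unset Strict Implicit.
Unset Printing Implicit Defensive.

Import Order.TTheory GRing.Theory Num.Theory.
Import numFieldNormedType.Exports.

Local Open Scope classical_set_scope.
Local Open Scope ring_scope.

(** * Comparison of integrals *)

(** The integral of a nonnegative function is the supremum of the integrals of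
the simple functions below it, so monotonicity holds without measurability. *)
Lemma ge0_integral_mono d (X : measurableType d) (R : realType)
    (mu : {measure set X -> \bar R}) (D : set X) (f g : X -> \bar R) :
  (forall x, D x -> 0 <= f x)%E -> (forall x, D x -> f x <= g x)%E ->
  (\int[mu]_(x in D) f x <= \int[mu]_(x in D) g x)%E.
Proof.
move=> f0 fg.
have g0 x : D x -> (0 <= g x)%E by move=> Dx; exact: le_trans (f0 _ Dx) (fg _ Dx).
rewrite !ge0_integralE//; apply: le_ereal_sup => _ [h hf <-]; exists h => // x.
by apply: le_trans (hf x) _; exact: lee_restrict.
Qed.

(** The positive part of f lies below g, hence has a finite integral.  If the
negative part has an infinite one, the real-valued integral of f is 0 by
convention, which is still below the integral of g. *)
Lemma Rintegral_le_majorant d (X : measurableType d) (R : realType)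
    (mu : {measure set X -> \bar R}) (D : set X) (f g : X -> R) :
  measurable D -> mu.-integrable D (EFin \o g) ->
  (forall x, D x -> 0 <= g x) -> (forall x, D x -> f x <= g x) ->
  \int[mu]_(x in D) f x <= \int[mu]_(x in D) g x.
Proof.
move=> mD ig g0 fg; rewrite /Rintegral.
have Gfin := integrable_fin_num mD ig.
have P0 : (0 <= \int[mu]_(x in D) (EFin \o f)^\+ x)%E by exact: integral_ge0.
have Q0 : (0 <= \int[mu]_(x in D) (EFin \o f)^\- x)%E by exact: integral_ge0.
have PG : (\int[mu]_(x in D) (EFin \o f)^\+ x <= \int[mu]_(x in D) (g x)%:E)%E.
  apply: ge0_integral_mono => // x Dx.
  by rewrite funeposE ge_max/= !lee_fin fg//= g0.
rewrite integralE.
have G0 : 0 <= fine (\int[mu]_(x in D) (g x)%:E).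
  by apply: fine_ge0; exact: le_trans PG.
move: PG P0 Q0 Gfin G0.
case: (\int[mu]_(x in D) (EFin \o f)^\+ x)%E => [p||] //=;
case: (\int[mu]_(x in D) (EFin \o f)^\- x)%E => [q||] //=;
case: (\int[mu]_(x in D) (g x)%:E)%E => [h||] //=.
by rewrite !lee_fin => ph p0 q0 _ _; lra.
Qed.

(** Truncating at 0 makes a function that is nonnegative almost everywhere
nonnegative everywhere; this lemma and the next one justify the replacement. *)
Lemma integrable_max0 d (X : measurableType d) (R : realType)
    (mu : {measure set X -> \bar R}) (D : set X) (f : X -> R) :
  measurable D -> mu.-integrable D (EFin \o f) ->
  mu.-integrable D (EFin \o (fun x => Num.max (f x) 0)).
Proof.
move=> mD fint; have -> : EFin \o (fun x => Num.max (f x) 0) = (EFin \o f)^\+%E.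
  by apply/funext => x; rewrite funeposE /= EFin_max.
exact: integrable_funepos.
Qed.

Lemma Rintegral_max0 d (X : measurableType d) (R : realType)
    (mu : {measure set X -> \bar R}) (D : set X) (f : X -> R) :
  measurable D -> mu.-integrable D (EFin \o f) ->
  {ae mu, forall x, D x -> 0 <= f x} ->
  \int[mu]_(x in D) Num.max (f x) 0 = \int[mu]_(x in D) f x.
Proof.
move=> mD fint [N [mN N0 fN]]; congr fine; apply: ae_eq_integral => //.
- exact: measurable_int (integrable_max0 mD fint).
- exact: measurable_int fint.
- exists N; split => // x /= xN; apply: fN => /= f0; apply: xN => Dx.
  by congr EFin; apply/max_idPl; exact: f0.
Qed.

(** * The singular kernel *)

Section kernel.
Context {R : realType}.
Local Notation mu := (@lebesgue_measure R).

Lemma Rintegral_indic_itv_le (r s d : R) : 0 <= d ->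
  \int[mu]_(x in `[r, s]) \1_(`[s - d, s] : set R) x <= d.
Proof.
move=> d0; rewrite /Rintegral integral_indic//=.
have -> : d = fine (d%:E) by [].
have le : (mu (`[(s - d)%R, s] `&` `[r, s]) <= d%:E)%E.
  apply: (@le_trans _ _ (mu `[(s - d)%R, s])).
    by apply: le_measure; rewrite ?inE//; exact: measurableI.
  rewrite lebesgue_measure_itv/=; case: ifP => _; rewrite ?lee_fin//.
  by lra.
apply: fine_le => //; rewrite ge0_fin_numE//.
by apply: le_lt_trans le _; exact: ltry.
Qed.

(** Before s - d the factor 1 / (s - x) is at most 1 / d, and after it the other
entry of the minimum is used, at the cost of c M^2 on a set of measure at most
d.  The window length d is left free, to be optimised by the caller. *)
Lemma Rintegral_min_kernel_le (phi a : R -> R) (c M d r s : R) :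
  0 <= c -> 0 < d ->
  mu.-integrable `[r, s] (EFin \o a) ->
  {ae mu, forall x, `[r, s]%classic x -> 0 <= a x} ->
  (forall x, r <= x <= s -> 0 <= phi x <= M) ->
  \int[mu]_(x in `[r, s])
     Num.min (c * phi x ^+ 2) ((1 + 1 / (s - x)) * a x)
  <= c * M ^+ 2 * d + (1 + 1 / d) * \int[mu]_(x in `[r, s]) a x.
Proof.
move=> c0 d0 ia a0 phiM.
(* The majorant must be nonnegative at every point, whereas a is so only almost
   everywhere; hence b. *)
pose b x := Num.max (a x) 0.
have ib : mu.-integrable `[r, s] (EFin \o b) by exact: integrable_max0.
have ab : \int[mu]_(x in `[r, s]) b x = \int[mu]_(x in `[r, s]) a x.
  exact: Rintegral_max0.
pose J : set R := `[s - d, s]%classic.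
have iJ : mu.-integrable `[r, s] (EFin \o \1_J).
  by apply: integrableS (integrable_indic_itv _ _ _ _).
have icJ : mu.-integrable `[r, s] (EFin \o (fun x => c * M ^+ 2 * \1_J x)).
  exact: (integrableZl _ (c * M ^+ 2) iJ).
have idb : mu.-integrable `[r, s] (EFin \o (fun x => (1 + 1 / d) * b x)).
  exact: (integrableZl _ (1 + 1 / d) ib).
have d'0 : 0 <= 1 + 1 / d by rewrite addr_ge0// divr_ge0// ltW.
have cM0 : 0 <= c * M ^+ 2 by rewrite mulr_ge0// sqr_ge0.
apply: (@le_trans _ _
  (\int[mu]_(x in `[r, s]) (c * M ^+ 2 * \1_J x + (1 + 1 / d) * b x))).
  apply: Rintegral_le_majorant => //.
  - exact: (integrableD _ icJ idb).
  - move=> x _; apply: addr_ge0; apply: mulr_ge0 => //.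
    by rewrite /b le_max lexx orbT.
  - move=> x; rewrite /= in_itv/= => rxs.
    have /andP[p0 pM] := phiM x rxs.
    have /andP[rx xs] := rxs.
    have b0 : 0 <= b x by rewrite /b le_max lexx orbT.
    (* The end point x = s, where 1 / (s - x) is 1 / 0 = 0, falls in J. *)
    rewrite ge_min indicE; have [xJ|xJ] := boolP (x \in J).
      apply/orP; left; rewrite mulr1 -[leLHS]addr0 lerD ?mulr_ge0//.
      by apply: ler_wpM2l => //; rewrite lerXn2r// ?nnegrE// (le_trans p0).
    apply/orP; right; rewrite mulr0 add0r.
    have xsd : d < s - x.
      move: xJ; rewrite notin_setE /J/= in_itv/= xs andbT => /negP.
      by rewrite -ltNge; lra.
    apply: (@le_trans _ _ ((1 + 1 / (s - x)) * b x)).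
      apply: ler_wpM2l; last by rewrite /b le_max lexx.
      by rewrite addr_ge0// divr_ge0//; lra.
    apply: ler_wpM2r => //; rewrite lerD2l !div1r lef_pV2 ?posrE//; lra.
rewrite RintegralD// RintegralZl// RintegralZl// ab lerD2r.
by apply: ler_wpM2l => //; exact/Rintegral_indic_itv_le/ltW.
Qed.

End kernel.

(** * Growth of the running supremum *)

(** By convexity, 2^(-x) lies on [0, 1] below its chord 1 - x/2. *)
Lemma ge1_two_powR_chord (R : realType) (x : R) : 0 <= x -> x <= 1 ->
  1 <= 2 `^ x * (1 - x / 2).
Proof.
move=> x0 x1; have p0 : 0 < 2 `^ x :> R by exact: powR_gt0.
suff : (2 `^ x)^-1 <= 1 - x / 2 :> R.
  by move=> /(ler_wpM2l (ltW p0)); rewrite mulfV ?gt_eqF.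
have := @convex_expR R (Itv01 x0 x1) (- ln 2) 0.
rewrite !convRE/= expR0 expRN lnK ?posrE// mulr0 addr0 mulr1 mulrN.
rewrite -powRN /powR pnatr_eq0/= mulNr => /le_trans; apply.
by rewrite /unstable.onem; lra.
Qed.

Section gronwall.
Context {R : realType} (c tau : R) (phi a : R -> R).
Local Notation mu := (@lebesgue_measure R).
Context (c_gt0 : 0 < c)
  (phi_ge0 : forall s, 0 <= s <= tau -> 0 <= phi s)
  (phi_ub : has_ubound (phi @` `[0, tau]))
  (a_int : mu.-integrable `[0, tau] (EFin \o a))
  (a_ge0 : {ae mu, forall s, `[0, tau]%classic s -> 0 <= a s})
  (phi_ineq : forall t0 t : R, 0 <= t0 -> t0 <= t -> t <= tau ->
    phi t <= phi t0 + \int[mu]_(s in `[t0, t])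
        Num.min (c * phi s ^+ 2) ((1 + 1 / (t - s)) * a s)).

Local Notation A := (fun t => \int[mu]_(s in `[0, t]) a s).
Definition running_sup t := sup (phi @` `[0, t]).
Local Notation S := running_sup.

Lemma a_int_sub r s : 0 <= r -> s <= tau -> mu.-integrable `[r, s] (EFin \o a).
Proof.
move=> r0 st; apply: integrableS a_int => //.
by apply: subset_itv; rewrite bnd_simp.
Qed.

Lemma a_ge0_sub r s : 0 <= r -> s <= tau ->
  {ae mu, forall x, `[r, s]%classic x -> 0 <= a x}.
Proof.
move=> r0 st; have [N [mN N0 aN]] := a_ge0; exists N; split => // x /= xN.
apply: aN => /= ax; apply: xN => /= xrs; apply: ax; move: xrs.
by rewrite !in_itv/= => /andP[rx xs]; rewrite (le_trans r0 rx) (le_trans xs st).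
Qed.

Lemma primitiveB r s : 0 <= r -> r <= s -> s <= tau ->
  \int[mu]_(x in `[r, s]) a x = A s - A r.
Proof.
move=> r0 rs st; rewrite Rintegral_itvB ?bnd_simp//; last exact: a_int_sub.
rewrite Rintegral_itv_obnd_cbnd//.
by apply: integrableS (a_int_sub r0 st) => //; exact: subset_itv_oc_cc.
Qed.

Lemma primitive_le r s : 0 <= r -> r <= s -> s <= tau -> A r <= A s.
Proof.
move=> r0 rs st; rewrite -subr_ge0 -primitiveB//.
rewrite -Rintegral_max0//; [|exact: a_int_sub|exact: a_ge0_sub].
by apply: Rintegral_ge0 => x _; rewrite le_max lexx orbT.
Qed.

Lemma primitive0 : A 0 = 0.
Proof. by rewrite /= set_itv1 Rintegral_set1. Qed.

Lemma has_ubound_sub t : t <= tau -> has_ubound (phi @` `[0, t]).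
Proof.
move=> tt; have [M phiM] := phi_ub; exists M => _ [x /= xt <-]; apply: phiM.
exists x => //=; move: xt; rewrite !in_itv/= => /andP[-> /le_trans]; exact.
Qed.

Lemma le_running_sup s t : 0 <= s -> s <= t -> t <= tau -> phi s <= S t.
Proof.
move=> s0 st tt; apply: ub_le_sup; first exact: has_ubound_sub.
by exists s => //=; rewrite in_itv/= s0.
Qed.

Lemma running_sup_le t M : 0 <= t ->
  (forall s, 0 <= s -> s <= t -> phi s <= M) -> S t <= M.
Proof.
move=> t0 h; apply: ge_sup; first by exists (phi 0), 0 => //=; rewrite in_itv/= lexx.
by move=> _ [s /= + <-]; rewrite in_itv/= => /andP[]; exact: h.
Qed.

Lemma running_sup_ge0 t : 0 <= t -> t <= tau -> 0 <= S t.
Proof.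
move=> t0 tt; apply: le_trans (le_running_sup (lexx 0) t0 tt).
by apply: phi_ge0; rewrite lexx (le_trans t0).
Qed.

Lemma running_sup0 : S 0 = phi 0.
Proof. by rewrite /running_sup set_itv1 image_set1 sup1. Qed.

(** Absorption: with d = 1 / (2 c S(t)) the window contributes c S(t)^2 d =
S(t) / 2, half of the left-hand side.  The bound has to be proved for phi(s) at
every s in [r, t], with this one d for all of them, before the supremum is
taken. *)
Lemma running_sup_step r t : 0 <= r -> r <= t -> t <= tau ->
  S t <= 2 * S r + (2 + 4 * c * S t) * (A t - A r).
Proof.
move=> r0 rt tt; have t0 := le_trans r0 rt.
have e0 : 0 <= A t - A r by rewrite subr_ge0 primitive_le.
have B0 := running_sup_ge0 r0 (le_trans rt tt).
have [Sle0|Sgt0] := leP (S t) 0.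
  have -> : S t = 0 by apply/le_anti; rewrite Sle0 running_sup_ge0.
  by rewrite mulr0 addr0 addr_ge0// mulr_ge0.
have cS : 0 < c * S t by exact: mulr_gt0.
set e := A t - A r in e0 *.
suff : S t <= S r + S t / 2 + (1 + 2 * c * S t) * e by lra.
have k0 : 0 <= (1 + 2 * c * S t) * e by rewrite mulr_ge0//; lra.
apply: running_sup_le => // s s0 st.
have [sr|/ltW rs] := leP s r.
  have := le_running_sup s0 sr (le_trans rt tt); lra.
have stau := le_trans st tt.
pose d := (2 * c * S t)^-1.
have d0 : 0 < d by rewrite invr_gt0; lra.
have := phi_ineq r0 rs stau.
have phiS x : r <= x <= s -> 0 <= phi x <= S t.
  move=> /andP[rx xs]; rewrite phi_ge0; last by rewrite (le_trans r0 rx) (le_trans xs).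
  by apply: le_running_sup; [exact: le_trans rx | exact: le_trans st |].
have := Rintegral_min_kernel_le (ltW c_gt0) d0 (a_int_sub r0 stau)
  (a_ge0_sub r0 stau) phiS.
rewrite primitiveB//.
have -> : c * S t ^+ 2 * d = S t / 2.
  by rewrite /d; field; rewrite !gt_eqF.
have -> : 1 / d = 2 * c * S t by rewrite /d div1r invrK.
have := le_running_sup r0 (lexx r) (le_trans rt tt).
have : (1 + 2 * c * S t) * (A s - A r) <= (1 + 2 * c * S t) * e.
  by apply: ler_wpM2l; [lra|rewrite lerD2r primitive_le].
lra.
Qed.

(** With x = 8 c A(t) and w = 1 - x/2, the inequality of [running_sup_step] from
time 0 reads S(t) w <= 2 phi(0) + (1 - w) / (2c).  As 2^x w >= 1, one may
multiply the claim by w^2 and drop the factor (2^x w)^2. *)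
Lemma running_sup_growth_base t : 0 <= t -> t <= tau -> 8 * c * A t <= 1 ->
  S t + 1 / (6 * c) <= 2 `^ (1 + 16 * c * A t) * (phi 0 + 1 / (8 * c)).
Proof.
move=> t0 tt At.
have cN0 : c != 0 by rewrite gt_eqF.
pose k := c^-1; have k0 : 0 < k by rewrite invr_gt0.
have -> : 1 / (6 * c) = k / 6 by rewrite /k; field.
have -> : 1 / (8 * c) = k / 8 by rewrite /k; field.
have phi00 : 0 <= phi 0 by apply: phi_ge0; rewrite lexx (le_trans t0).
set x := 8 * c * A t in At; have At0 : 0 <= x.
  rewrite mulr_ge0 ?mulr_ge0 ?(ltW c_gt0)//.
  by have := primitive_le (lexx 0) t0 tt; rewrite primitive0.
have := running_sup_step (lexx 0) t0 tt.
rewrite running_sup0 primitive0 subr0.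
have -> : (2 + 4 * c * S t) * A t = x * k / 4 + x / 2 * S t.
  by rewrite /x /k; field.
have -> : 2 `^ (1 + 16 * c * A t) = 2 * (2 `^ x) ^+ 2.
  rewrite powRD ?pnatr_eq0 ?implybT// powRr1// -powR_mulrn ?powR_ge0//.
  by rewrite -powRrM; congr (_ * 2 `^ _); rewrite /x; ring.
move=> Sx.
have := ge1_two_powR_chord At0 At; set p := 2 `^ x; set w := 1 - x / 2 => pw.
have p0 : 0 < p by exact: powR_gt0.
have w0 : 0 < w by rewrite /w; lra.
have w1 : w <= 1 by rewrite /w; lra.
have Sw : S t * w <= 2 * phi 0 + (1 - w) * k / 2 by rewrite /w; lra.
rewrite -(ler_pM2r (exprn_gt0 2 w0)).
have pw2 : 1 <= p ^+ 2 * w ^+ 2 by rewrite -exprMn exprn_ege1.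
have h0 : 0 <= phi 0 + k / 8 by rewrite addr_ge0// divr_ge0// ltW.
apply: (@le_trans _ _ (2 * (phi 0 + k / 8))); last first.
  rewrite [leRHS](_ : _ = (p ^+ 2 * w ^+ 2) * (2 * (phi 0 + k / 8))); last by ring.
  by rewrite ler_peMl// mulr_ge0.
have : S t * w * w <= (2 * phi 0 + (1 - w) * k / 2) * w by rewrite ler_pM2r.
have : phi 0 * w <= phi 0 by rewrite ler_piMr.
(* What remains is w / 2 - w^2 / 3 <= 1 / 4, and the difference of the two sides
   is (w - 3/4)^2 / 3 + 1 / 16. *)
have : 0 <= k * (w - 3 / 4) ^+ 2 by rewrite mulr_ge0 ?sqr_ge0// ltW.
nra.
Qed.

(** The shift by 1/(6c) makes the full step homogeneous: when A(t) - A(r) =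
1/(8c), [running_sup_step] becomes S(t) <= 4 S(r) + 1/(2c), that is
S(t) + 1/(6c) <= 4 (S(r) + 1/(6c)). *)
Lemma running_sup_growth n t : 0 <= t -> t <= tau -> 8 * c * A t <= n.+1%:R ->
  S t + 1 / (6 * c) <= 2 `^ (1 + 16 * c * A t) * (phi 0 + 1 / (8 * c)).
Proof.
have cN0 : c != 0 by rewrite gt_eqF.
pose k := c^-1; have k0 : 0 < k by rewrite invr_gt0.
have kA x : x = (8 * c * x) * (k / 8) by rewrite /k; field.
elim: n t => [|n IHn] t t0 tt At; first exact: running_sup_growth_base.
have [At1|At1] := leP (8 * c * A t) 1.
  exact: running_sup_growth_base.
have E6 : 1 / (6 * c) = k / 6 by rewrite /k; field.
have E8 : 1 / (8 * c) = k / 8 by rewrite /k; field.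
have Acont : {within `[0, t], continuous A}.
  exact: parameterized_integral_continuous t0 (a_int_sub (lexx 0) tt).
have [r] : exists2 r, r \in `[0, t] & A r = A t - k / 8.
  apply: IVT => //; rewrite primitive0 ge_min le_max.
  have kAt : k / 8 <= A t by rewrite [leRHS]kA ler_peMl ?divr_ge0// ltW.
  have k8 : 0 <= k / 8 by rewrite divr_ge0// ltW.
  by rewrite subr_ge0 kAt gerBl k8 orbT.
rewrite in_itv/= => /andP[r0 rt] Ar.
have rtau := le_trans rt tt.
have : 8 * c * A r <= n.+1%:R.
  rewrite Ar mulrBr (_ : 8 * c * (k / 8) = 1); last by rewrite /k; field.
  by rewrite lerBlDr natr1.
move=> /(IHn _ r0 rtau); rewrite E6 E8.
have -> : 1 + 16 * c * A r = (1 + 16 * c * A t) - 2%:R.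
  by rewrite Ar /k; field.
rewrite powRB ?pnatr_eq0 ?implybT// powR_mulrn//.
have := running_sup_step r0 rt tt; rewrite Ar.
have -> : (2 + 4 * c * S t) * (A t - (A t - k / 8)) = k / 4 + S t / 2.
  by rewrite /k; field.
set P := 2 `^ _; lra.
Qed.
End gronwall.

(** * The estimate *)

Lemma measurable_time_interval (R : realType) (T : \bar R) :
  measurable (time_interval T).
Proof.
case: T => [T||].
- rewrite (_ : time_interval _ = `[0, T[%classic)//.
  by apply/seteqP; split => x; rewrite /time_interval/= in_itv/= lte_fin => /andP.
- rewrite (_ : time_interval _ = `[0, +oo[%classic)//.
  apply/seteqP; split => x; rewrite /time_interval/= in_itv/= andbT; first by case.
  by move=> x0; split => //; exact: ltry.
- by rewrite (_ : time_interval _ = set0)//; apply/seteqP; split => x // [].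
Qed.

Theorem lemma5p4 (R : realType) (T : \bar R) (c : R) (phi a : R -> R)
  (T_gt0 : (0 < T)%E) (c_gt0 : 0 < c)
  (phi_Linfty_loc : Linfty_loc (time_interval T) phi)
  (phi_ge0 : forall t, time_interval T t -> 0 <= phi t)
  (phi_locally_bounded : locally_bounded (time_interval T) phi)
  (a_L1 : (@lebesgue_measure R).-integrable (time_interval T) (EFin \o a))
  (a_ge0 : {ae @lebesgue_measure R, forall s, time_interval T s -> 0 <= a s})
  (phi_ineq : forall t0 t : R, 0 <= t0 -> t0 <= t -> (t%:E < T)%E ->
    phi t <= phi t0 +
      \int[@lebesgue_measure R]_(s in `[t0, t])
        Num.min (c * phi s ^+ 2) ((1 + 1 / (t - s)) * a s)) :
  forall t : R, time_interval T t ->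
    phi t <= 2 `^ (1 + 16 * c * \int[@lebesgue_measure R]_(s in `[0, t]) a s)
             * (phi 0 + 1 / (8 * c)).
Proof.
move=> t [t0 tT].
have sub : `[0, t] `<=` time_interval T.
  move=> s; rewrite /= in_itv/= => /andP[s0 st]; split => //.
  by apply: le_lt_trans tT; rewrite lee_fin.
have phi0 s : 0 <= s <= t -> 0 <= phi s.
  by move=> st; apply: phi_ge0; apply: sub; rewrite /= in_itv.
have phiB : has_ubound (phi @` `[0, t]).
  have [M [_ phiM]] := phi_locally_bounded _ _ sub.
  exists (M + 1) => _ [s st <-]; apply: le_trans (ler_norm _) _.
  by apply: (phiM (M + 1)) => //; rewrite ltrDl.
have aint : lebesgue_measure.-integrable `[0, t] (EFin \o a).
  by apply: integrableS a_L1 => //; exact: measurable_time_interval.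
have apos : {ae @lebesgue_measure R, forall s, `[0, t]%classic s -> 0 <= a s}.
  have [N [mN N0 aN]] := a_ge0; exists N; split => // x /= xN.
  by apply: aN => /= ax; apply: xN => /sub/ax.
have ineq r s : 0 <= r -> r <= s -> s <= t ->
  phi s <= phi r + \int[@lebesgue_measure R]_(x in `[r, s])
        Num.min (c * phi x ^+ 2) ((1 + 1 / (s - x)) * a x).
  by move=> r0 rs st; apply: phi_ineq => //; apply: le_lt_trans tT; rewrite lee_fin.
have := running_sup_growth c_gt0 phi0 phiB aint apos ineq t0 (lexx t)
  (ltW (truncnS_gt _)).
apply: le_trans; apply: (@le_trans _ _ (running_sup phi t)).
  exact: le_running_sup phiB _ _ t0 (lexx t) (lexx t).
by rewrite lerDl divr_ge0// mulr_ge0// ltW.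
Qed.
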